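(* Let $\mathcal X$ be an ordered topological vector space, let $\mathcal A\subset\mathcal X$ be a closed acceptance set and $S=(S_0,S_T)$ a traded asset with pricing functional $\pi$. Then $\rho_{\mathcal A,S,\pi}$ is quasiconvex if and only if $\mathcal A$ is convex.
   Context: An ordered topological vector space $\mathcal X$ is a Hausdorff real topological vector space ordered by a pointed convex cone $\mathcal X_+$ ($\mathcal X_+\cap(-\mathcal X_+)=\{0\}$); $X\le Y$ means $Y-X\in\mathcal X_+$. An acceptance set is a nonempty proper subset $\mathcal A\subset\mathcal X$ such that $X\in\mathcal A$ and $Y\ge X$ imply $Y\in\mathcal A$. A traded asset is a pair $S=(S_0,S_T)$ with $S_0>0$ real and $S_T\in\mathcal X_+$ nonzero. A pricing functional for $S$ is a strictly increasing function $\pi:\mathbb R\to\mathbb R$ (not necessarily continuous) with $\pi(0)=0$ and $\pi(1)=S_0$. Define $\rho_{\mathcal A,S,\pi}:\mathcal X\to\mathbb R\cup\{\pm\infty\}$ by $$\rho_{\mathcal A,S,\pi}(X)=\inf\{\pi(\lambda) : \lambda\in\mathbb R,\ X+\lambda S_T\in\mathcal A\},\qquad\inf\emptyset=\infty.$$ A function $\rho:\mathcal X\to\mathbb R\cup\{\pm\infty\}$ is quasiconvex if $\{X\in\mathcal X : \rho(X)\le\alpha\}$ is convex for every $\alpha\in\mathbb R$. *)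

(* Defs.v *)
From mathcomp Require Import all_boot all_order all_algebra.
From mathcomp Require Import all_classical all_reals all_analysis.

Set Implicit Arguments.
Unset Strict Implicit.
Unset Printing Implicit Defensive.

Import Order.TTheory GRing.Theory Num.Theory.
Import numFieldNormedType.Exports.

Local Open Scope classical_set_scope.
Local Open Scope ring_scope.

(* [topologicalLmodType R] is used for topological vector spaces because the
   library's [tvsType R] additionally requires local convexity. *)

Definition pointed_convex_cone (R : realType) (X : lmodType R) (K : set X) :=
  [/\ forall (t : R) (x : X), 0 <= t -> K x -> K (t *: x),
      convex_set K
    & K `&` (-%R @` K) = [set 0]].

Definition ordered_tvs (R : realType) (X : topologicalLmodType R)
    (K : set X) :=
  hausdorff_space X /\ pointed_convex_cone K.

Definition cone_le (R : realType) (X : lmodType R) (K : set X) (x y : X) :=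
  K (y - x).

Definition acceptance_set (R : realType) (X : lmodType R) (K A : set X) :=
  [/\ A !=set0, A <> setT & forall x y : X, A x -> cone_le K x y -> A y].

(* [S] is the pair (S_0, S_T). *)
Definition traded_asset (R : realType) (X : lmodType R) (K : set X)
    (S : R * X) :=
  [/\ 0 < S.1, K S.2 & S.2 <> 0].

Definition pricing_functional (R : realType) (X : lmodType R) (S : R * X)
    (pi : R -> R) :=
  [/\ {homo pi : x y / x < y}, pi 0 = 0 & pi 1 = S.1].

Definition risk_measure (R : realType) (X : lmodType R) (A : set X)
    (S : R * X) (pi : R -> R) (x : X) : \bar R :=
  ereal_inf [set (pi l)%:E | l in [set l : R | A (x + l *: S.2)]].

Definition quasiconvex (R : realType) (X : lmodType R) (rho : X -> \bar R) :=
  forall a : R, convex_set [set x : X | (rho x <= a%:E)%E].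

(* Main.v *)
(** Upward closedness in the direction [S_T] makes the acceptable multiples of
    [S_T] at two positions comparable: the larger of the two serves both, so
    convexity of [A] passes to the sublevel sets.  Conversely, strict
    monotonicity of [pi] forces [rho X <= 0] exactly when [X + l S_T] is in [A]
    for all [l > 0], hence, [A] being closed, exactly when [X] is in [A]; so
    [A] is the sublevel set of [rho] at level [0]. *)
Require Import Defs.
From mathcomp Require Import all_boot all_order all_algebra.
From mathcomp Require Import all_classical all_reals all_analysis.

Set Implicit Arguments.
Unset Strict Implicit.
Unset Printing Implicit Defensive.

Import Order.TTheory GRing.Theory Num.Theory.
Import numFieldNormedType.Exports.

Local Open Scope classical_set_scope.
Local Open Scope ring_scope.

Lemma acceptance_set_shift (R : realType) (X : lmodType R) (K A : set X)
    (v x : X) (l m : R) :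
  pointed_convex_cone K -> acceptance_set K A -> K v -> l <= m ->
  A (x + l *: v) -> A (x + m *: v).
Proof.
move=> [Kscale _ _] [_ _ Aup] Kv lm /Aup; apply; rewrite /cone_le.
rewrite opprD addrACA subrr add0r -scalerBl.
by apply: Kscale => //; rewrite subr_ge0.
Qed.

(** Idempotence writes [v] as [conv t v v], and the two combinations then add termwise. *)
Lemma conv_translate (R : numDomainType) (X : lmodType R)
    (x y v : convex_lmodType X) (t : {i01 R}) :
  conv t x y + v = conv t (x + v : convex_lmodType X) (y + v).
Proof.
rewrite -[in LHS](convmm t v) /conv/=.
by rewrite [in RHS]scalerDr [in RHS]scalerDr addrACA.
Qed.

(** The infimum need not be attained, so only a strict bound yields an actual multiple [l]. *)
Lemma risk_measure_lt (R : realType) (X : lmodType R) (A : set X) (S : R * X)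
    (pi : R -> R) (x : X) (b : R) :
  (risk_measure A S pi x < b%:E)%E <-> exists2 l, A (x + l *: S.2) & pi l < b.
Proof.
split=> [/ereal_inf_lt[_ [l Al <-]]|[l Al lb]].
  by rewrite lte_fin => lb; exists l.
apply: (@le_lt_trans _ _ (pi l)%:E); last by rewrite lte_fin.
by apply: ereal_inf_lbound; exists l.
Qed.

Lemma convex_quasiconvex (R : realType) (X : lmodType R) (K A : set X)
    (S : R * X) (pi : R -> R) :
  pointed_convex_cone K -> acceptance_set K A -> K S.2 -> convex_set A ->
  quasiconvex (risk_measure A S pi).
Proof.
move=> hK hA KS cA a x y t; rewrite !inE/= => xa ya.
(* The slack [e] makes the bounds at [x] and [y] strict, which provides witnesses [l] and [m]. *)
apply/lee_addgt0Pr => e e0; rewrite -EFinD; apply: ltW.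
have ae : (a%:E < (a + e)%:E)%E by rewrite lte_fin ltrDl.
have /risk_measure_lt[l Al lae] := le_lt_trans xa ae.
have /risk_measure_lt[m Am mae] := le_lt_trans ya ae.
(* The price of the maximum is [pi l] or [pi m], both below [a + e]. *)
apply/risk_measure_lt; exists (Num.max l m); last by rewrite maxEle; case: ifP.
rewrite (@conv_translate _ X); apply/set_mem/cA; apply/mem_set.
- by apply: (acceptance_set_shift hK hA KS _ Al); rewrite le_max lexx.
- by apply: (acceptance_set_shift hK hA KS _ Am); rewrite le_max lexx orbT.
Qed.

(** By continuity of the vector space operations, [x] is the limit of [x + l *: v] as [l] decreases
    to 0. *)
Lemma closed_ray (R : realType) (X : topologicalLmodType R) (A : set X)
    (x v : X) :
  closed A -> (forall l : R, 0 < l -> A (x + l *: v)) -> A x.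
Proof.
move=> Acl Al.
have cvgx : x + l *: v @[l --> (0 : R)^'+] --> x.
  rewrite -[X in _ --> X](addr0 x) -(scale0r v).
  have cvgv : l *: v @[l --> (0 : R)^'+] --> (0 : R) *: v.
    apply: (@continuous2_cvg _ R^o X X _ _ id (fun=> v) *:%R).
    - exact: (@scale_continuous R X (0, v)).
    - exact: cvg_at_right_filter.
    - exact: cvg_cst.
  apply: (@continuous2_cvg _ X X X _ _ (fun=> x) (fun l : R => l *: v) +%R).
  - exact: (@add_continuous X (x, 0 *: v)).
  - exact: cvg_cst.
  - exact: cvgv.
have nearA : \forall l \near (0 : R)^'+, A (x + l *: v).
  by near=> l; apply: Al.
exact: (closed_cvg A Acl nearA x cvgx).
Unshelve. all: by end_near. Qed.

Lemma risk_measure_le0 (R : realType) (X : topologicalLmodType R)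
    (K A : set X) (S : R * X) (pi : R -> R) (x : X) :
  pointed_convex_cone K -> acceptance_set K A -> closed A -> K S.2 ->
  {homo pi : l m / l < m} -> pi 0 = 0 ->
  (risk_measure A S pi x <= 0)%E <-> A x.
Proof.
move=> hK hA Acl KS pimono pi0; split=> [rho0|Ax].
  apply: (closed_ray Acl (v := S.2)) => l l0.
  (* Since [0 = pi 0 < pi l], some acceptable [m] costs less than [pi l]; strict monotonicity
     reflects this to [m <= l], without continuity of [pi]. *)
  have /risk_measure_lt[m Am ml] : (risk_measure A S pi x < (pi l)%:E)%E.
    by apply: (le_lt_trans rho0); rewrite lte_fin -pi0 pimono.
  by apply: (acceptance_set_shift hK hA KS _ Am); rewrite -(le_mono pimono) ltW.
(* The zero multiple is acceptable and has price [pi 0 = 0]. *)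
by apply: ereal_inf_lbound; exists 0; rewrite /= ?pi0 ?scale0r ?addr0.
Qed.

Theorem proposition5p10 (R : realType) (X : topologicalLmodType R)
    (K : set X) (hX : ordered_tvs K)
    (A : set X) (hA : acceptance_set K A) (hAc : closed A)
    (S : R * X) (hS : traded_asset K S)
    (pi : R -> R) (hpi : pricing_functional S pi) :
  quasiconvex (risk_measure A S pi) <-> convex_set A.
Proof.
have [_ hK] := hX; have [_ KS _] := hS; have [pimono pi0 _] := hpi.
split; last exact: convex_quasiconvex hK hA KS.
suff sublevel0 : [set x | (risk_measure A S pi x <= 0%:E)%E] = A.
  by move=> /(_ 0); rewrite sublevel0.
by apply/seteqP; split=> x /(risk_measure_le0 x hK hA hAc KS pimono pi0).
Qed.
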